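(* Let $S$ be a commutative semigroup with $0$. Then the following hold: (a) If $|\mathrm{Ass}(S)|\ge 2$ and $\mathfrak p=\mathrm{Ann}(x)$, $\mathfrak q=\mathrm{Ann}(y)$ are two distinct elements of $\mathrm{Ass}(S)$ (with $x,y\in S$ nonzero), then $xy=0$. (b) If $|\mathrm{Ass}(S)|\ge 3$, then the girth of $\Gamma(S)$ is $3$. (c) If $|\mathrm{Ass}(S)|\ge 5$, then $\Gamma(S)$ is not planar.
   Context: A commutative semigroup with $0$ is a commutative semigroup $S$ with an element $0$ such that $0s=0$ for all $s\in S$. A zero-divisor is an element $x\in S$ with $xy=0$ for some $y\in S$, $y\neq 0$; $Z(S)$ is the set of zero-divisors. The zero-divisor graph $\Gamma(S)$ is the simple undirected graph with vertex set $Z(S)\setminus\{0\}$, where distinct $x,y$ are adjacent iff $xy=0$. A non-empty subset $I\subseteq S$ is an ideal if $xS\subseteq I$ for every $x\in I$; an ideal $\mathfrak p$ is prime if for all $x,y\in S$, $xSy\subseteq\mathfrak p$ implies $x\in\mathfrak p$ or $y\in\mathfrak p$. For $x\in S$, $\mathrm{Ann}(x)=\{s\in S: sx=0\}$. $\mathrm{Ass}(S)$ is the set of prime ideals $\mathfrak p$ of $S$ such that $\mathfrak p=\mathrm{Ann}(x)$ for some nonzero $x\in S$. The girth of a graph is the length of a shortest cycle. A graph is planar if it can be drawn in the plane so that no two edges meet except at a vertex with which both are incident. *)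

(* Defs.v *)
From HB Require Import structures.
From mathcomp Require Import all_boot all_order all_algebra.
From mathcomp Require Import all_classical all_reals all_analysis.
Set Implicit Arguments.
Unset Strict Implicit.
Unset Printing Implicit Defensive.
Import Order.TTheory GRing.Theory Num.Theory.
Import numFieldNormedType.Exports.
Local Open Scope classical_set_scope.
Local Open Scope card_scope.

HB.mixin Record Semigroup_isComSemigroup0 S of Semigroup S := {
  szero : S;
  smulC : forall x y : S, (x * y)%g = (y * x)%g;
  smul0 : forall x : S, (szero * x)%g = szero
}.

#[short(type="comSemigroup0Type")]
HB.structure Definition ComSemigroup0 :=
  {S of Semigroup_isComSemigroup0 S & Semigroup S}.

Section Ideals.
Variable S : comSemigroup0Type.
Local Open Scope group_scope.
Implicit Types (x y s : S) (I p : set S).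

Definition zero_divisor x := exists2 y, y <> szero & x * y = szero.

Definition is_ideal I :=
  I !=set0 /\ forall x s, I x -> I (x * s).

(* The whole semigroup counts as a prime ideal. *)
Definition is_prime p :=
  is_ideal p /\
  forall x y, (forall s, p (x * s * y)) -> p x \/ p y.

Definition Ann x : set S := [set s | s * x = szero].

End Ideals.

Definition Ass (S : comSemigroup0Type) : set (set S) :=
  [set p | is_prime p /\ exists2 x : S, x <> szero & p = Ann x].
Arguments Ass S : clear implicits.

Record ugraph (T : eqType) := UGraph {
  verts : set T;
  adj : rel T;
  adj_sym : symmetric adj;
  adj_irrefl : irreflexive adj;
  adj_verts : forall x y, adj x y -> verts x
}.

Section ZeroDivisorGraph.
Variable S : comSemigroup0Type.
Local Open Scope group_scope.

Definition zd_verts : set S := [set x | zero_divisor x /\ x <> szero].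

Definition zd_adj : rel S := fun x y =>
  [&& x \in zd_verts, y \in zd_verts, x != y & x * y == szero].

Lemma zd_adj_sym : symmetric zd_adj.
Proof. by move=> x y; rewrite /zd_adj andbCA eq_sym smulC. Qed.

Lemma zd_adj_irrefl : irreflexive zd_adj.
Proof. by move=> x; rewrite /zd_adj eqxx !andbF. Qed.

Lemma zd_adj_verts x y : zd_adj x y -> zd_verts x.
Proof. by case/andP => /set_mem. Qed.

Definition zd_graph : ugraph S := UGraph zd_adj_sym zd_adj_irrefl zd_adj_verts.

End ZeroDivisorGraph.

Section Girth.
Variables (T : eqType) (G : ugraph T).

Definition graph_cycle (c : seq T) : bool :=
  [&& (3 <= size c)%N, uniq c & cycle (adj G) c].

Definition girth_is (n : nat) :=
  (exists2 c, graph_cycle c & size c = n) /\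
  forall c, graph_cycle c -> (n <= size c)%N.

End Girth.

Section Planarity.
Variable R : realType.
Local Open Scope ring_scope.

Definition is_arc (a b : R * R) (A : set (R * R)) :=
  exists g : R -> R * R,
    [/\ {within `[0, 1], continuous g}, set_inj `[0, 1] g,
        g 0 = a, g 1 = b & g @` `[0, 1] = A].

Variables (T : eqType) (G : ugraph T).

Definition edges : set (set T) :=
  [set e | exists x y, adj G x y /\ e = [set x; y]].

(* An edge is the set of its two endpoints, so that [w \in e] is incidence. *)
Record is_plane_drawing (pos : T -> R * R) (arc : set T -> set (R * R)) : Prop := {
  drawing_inj : set_inj (verts G) pos;
  drawing_arc : forall x y, adj G x y -> is_arc (pos x) (pos y) (arc [set x; y]);
  drawing_vertex : forall e w, edges e -> verts G w -> arc e (pos w) -> e w;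
  drawing_edges : forall e f, edges e -> edges f -> e <> f ->
    arc e `&` arc f `<=` pos @` (e `&` f)
}.

Definition planar := exists pos arc, is_plane_drawing pos arc.

End Planarity.

(* Main.v *)
Require Import Defs.
From mathcomp Require Import all_boot all_order all_algebra.
From mathcomp Require Import all_classical all_reals all_analysis.
From mathcomp Require Import ring lra.
Set Implicit Arguments.
Unset Strict Implicit.
Unset Printing Implicit Defensive.
Import Order.TTheory GRing.Theory Num.Theory.
Local Open Scope classical_set_scope.
Local Open Scope card_scope.

(* If p = Ann x and q = Ann y are prime and xy <> 0, then sx = 0 gives
   s S x in q with x outside q, so that p is contained in q, and symmetrically:
   distinct associated primes have annihilating generators, and n of them give
   a clique K_n in the zero-divisor graph.

   K_5 is not planar because of van Kampen's parity argument.  Disjoint arcs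
   lie at positive distance, so a drawing of K_5 can be replaced by polygonal
   paths in general position such that no two paths of independent edges cross.
   A polygonal path crosses a closed polygonal curve as often, modulo 2, as the
   segment between its end points does.  The edges independent of a given edge
   form a triangle, so straightening the ten edges one after the other keeps
   the parity of the number of crossings of independent edges.  But that number
   is odd for straight edges between any five points in general position. *)

(** * Exhaustive checks over Booleans *)

Definition both (f : bool -> bool) := f true && f false.

Lemma bothP f : both f -> forall b, f b.
Proof. by case/andP => ft ff []. Qed.

(** One closed Boolean term covers all 1024 cases, so that [vm_compute] decides them; ten is the
    number of triples among five points. *)
Lemma bool10_ind (f : bool -> bool -> bool -> bool -> bool ->
                      bool -> bool -> bool -> bool -> bool -> bool) :
  both (fun b0 => both (fun b1 => both (fun b2 => both (fun b3 => both (fun b4 =>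
  both (fun b5 => both (fun b6 => both (fun b7 => both (fun b8 => both (fun b9 =>
    f b0 b1 b2 b3 b4 b5 b6 b7 b8 b9)))))))))) ->
  forall b0 b1 b2 b3 b4 b5 b6 b7 b8 b9, f b0 b1 b2 b3 b4 b5 b6 b7 b8 b9.
Proof.
by do 10!(let b := fresh "b" in move=> /bothP H b; move: {H}(H b)).
Qed.

Lemma uniq5_neq (T : eqType) (a b c d e : T) : uniq [:: a; b; c; d; e] ->
  [/\ [/\ a != b, a != c, a != d & a != e], [/\ b != c, b != d & b != e],
      c != d /\ c != e & d != e].
Proof.
rewrite /= !inE !negb_or.
by case/and5P => /and4P[-> -> -> ->] /and3P[-> -> ->] /andP[-> ->] ->.
Qed.

(** * Orientations and crossings of segments in the plane *)

Section Crossings.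
Local Open Scope ring_scope.
Context {R : realFieldType}.
Implicit Types a b c d e : R * R.

(** Twice the signed area of the triangle. *)
Definition det3 a b c : R :=
  (b.1 - a.1) * (c.2 - a.2) - (b.2 - a.2) * (c.1 - a.1).

Definition ori a b c : bool := 0 < det3 a b c.

(** For points in general position: the two segments intersect. *)
Definition crosses a b c d : bool :=
  (ori a b c != ori a b d) && (ori c d a != ori c d b).

Lemma ori_cycle a b c : ori b c a = ori a b c.
Proof. by rewrite /ori; congr (0 < _); rewrite /det3; ring. Qed.

Lemma ori_swap a b c : det3 a b c != 0 -> ori b a c = ~~ ori a b c.
Proof.
move=> nz; have -> : ori b a c = (det3 a b c < 0).
  by rewrite /ori -oppr_gt0; congr (0 < _); rewrite /det3; ring.
by rewrite /ori -leNgt le_eqVlt (negPf nz).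
Qed.

Lemma ori_swapr a b c : det3 a b c != 0 -> ori a c b = ~~ ori a b c.
Proof. by rewrite (ori_cycle b); apply: ori_swap. Qed.

Lemma crossesC a b c d : crosses a b c d = crosses c d a b.
Proof. by rewrite /crosses andbC. Qed.

Lemma det3xx a c : det3 a a c = 0.
Proof. by rewrite /det3; ring. Qed.

Lemma crossesxx a c d : crosses a a c d = false.
Proof. by rewrite /crosses /ori !det3xx eqxx. Qed.

Lemma crossesxxr a b c : crosses a b c c = false.
Proof. by rewrite crossesC crossesxx. Qed.

Lemma crossesNl a b c d : det3 a b c != 0 -> det3 a b d != 0 ->
  crosses b a c d = crosses a b c d.
Proof.
move=> nzc nzd; rewrite /crosses !(@ori_swap a b) // (inj_eq negb_inj).
by rewrite [ori c d b == _]eq_sym.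
Qed.

(** [l] is the zero of the affine function with values [x] at 0 and [y] at 1. *)
Lemma opposite_ratio (x y : R) : (0 < x) != (0 < y) ->
  exists2 l, 0 <= l <= 1 & l * (x - y) = x.
Proof.
move=> neq; have nz : x - y != 0.
  by rewrite subr_eq0; apply: contraNneq neq => ->.
exists (x / (x - y)); last by rewrite divfK.
move: neq; case: (ltrP 0 x) => x0; case: (ltrP 0 y) => y0 // _.
  by rewrite ler_pdivlMr ?ler_pdivrMr; lra.
by rewrite ler_ndivlMr ?ler_ndivrMr; lra.
Qed.

Lemma convex_near (l x y p r : R) : 0 <= l <= 1 ->
  `|x - p| < r -> `|y - p| < r -> `|x + l * (y - x) - p| < r.
Proof.
move=> /andP[l0 l1] xp yp; pose m := Num.max `|x - p| `|y - p|.
have mr : m < r by rewrite gt_max xp yp.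
have -> : x + l * (y - x) - p = (1 - l) * (x - p) + l * (y - p) by ring.
apply: le_lt_trans (ler_normD _ _) _; rewrite !normrM.
rewrite (ger0_norm l0) (@ger0_norm _ (1 - l)) ?subr_ge0 //.
apply: le_lt_trans mr; have -> : m = (1 - l) * m + l * m by ring.
by rewrite lerD // ler_wpM2l ?subr_ge0 // le_max lexx ?orbT.
Qed.

(* The point cutting [a, b] in the ratio det3 c d a : - det3 c d b also lies
   on [c, d]. *)
Lemma crosses_close a b c d (p q : R * R) (r : R) :
  `|a.1 - p.1| < r -> `|a.2 - p.2| < r -> `|b.1 - p.1| < r -> `|b.2 - p.2| < r ->
  `|c.1 - q.1| < r -> `|c.2 - q.2| < r -> `|d.1 - q.1| < r -> `|d.2 - q.2| < r ->
  crosses a b c d -> `|p.1 - q.1| < r + r /\ `|p.2 - q.2| < r + r.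
Proof.
move=> a1 a2 b1 b2 c1 c2 d1 d2 /andP[ab cd].
have [l l01 ab_l] := opposite_ratio cd.
have [m m01 cd_m] := opposite_ratio ab.
(* [D] is also [det3 a b d - det3 a b c], hence a common denominator of [l] and [m]. *)
pose D := det3 c d a - det3 c d b.
have D0 : D != 0.
  rewrite subr_eq0; apply: contraNneq cd; rewrite /ori => ->.
  by rewrite eqxx.
have lD : D * l = det3 c d a by rewrite mulrC.
have mD : D * m = - det3 a b c by rewrite -cd_m /D /det3; ring.
have meet1 : a.1 + l * (b.1 - a.1) = c.1 + m * (d.1 - c.1).
  by apply: (mulfI D0); rewrite !mulrDr !mulrA lD mD /D /det3; ring.
have meet2 : a.2 + l * (b.2 - a.2) = c.2 + m * (d.2 - c.2).
  by apply: (mulfI D0); rewrite !mulrDr !mulrA lD mD /D /det3; ring.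
have near1 := convex_near l01 a1 b1; have near1' := convex_near m01 c1 d1.
have near2 := convex_near l01 a2 b2; have near2' := convex_near m01 c2 d2.
rewrite meet1 distrC in near1; rewrite meet2 distrC in near2.
by split; apply: le_lt_trans (ler_distD _ _ _) (ltrD _ _); eassumption.
Qed.

End Crossings.

(** * Points in general position, and crossing parities of walks through them *)

Section GenericConfigurations.
Local Open Scope ring_scope.
Context {R : realFieldType} {I : eqType} (P : I -> R * R).

Definition generic := forall i j k, i != j -> j != k -> i != k ->
  det3 (P i) (P j) (P k) != 0.

Hypothesis genP : generic.
Implicit Types i j : I.

Let o i j (k : I) := ori (P i) (P j) (P k).
Let cr i j (k l : I) := crosses (P i) (P j) (P k) (P l).

(** The sign condition forced by a three-term relation [x * x' - y * y' + z * z' = 0]: the middle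
    product is the sum of the outer ones. *)
Definition pluecker_signs (x x' y y' z z' : bool) :=
  ((x == x') == (z == z')) ==> ((x == x') == (y == y')).

(** In the excluded patterns the four terms of [x - y + z - t] have the same sign, so that they
    cannot sum to 0. *)
Definition affine_signs (x y z t : bool) := ~~ [&& x != y, x == z & x != t].

Lemma pluecker_signsP (x x' y y' z z' : R) :
  x != 0 -> x' != 0 -> y != 0 -> y' != 0 -> z != 0 -> z' != 0 ->
  x * x' - y * y' + z * z' = 0 ->
  pluecker_signs (0 < x) (0 < x') (0 < y) (0 < y') (0 < z) (0 < z').
Proof.
have sgM (u v : R) : u != 0 -> v != 0 -> ((0 < u) == (0 < v)) = (0 < u * v).
  case: (ltgtP 0 u) => // u0 _; case: (ltgtP 0 v) => // v0 _.
  - by rewrite mulr_gt0.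
  - by rewrite ltNge pmulr_rle0 // ltW.
  - by rewrite ltNge nmulr_rle0 // ltW.
  - by rewrite nmulr_rgt0.
move=> x0 x'0 y0 y'0 z0 z'0 E; rewrite /pluecker_signs.
rewrite (sgM x x') // (sgM y y') // (sgM z z') //.
have: x * x' != 0 by rewrite mulf_neq0.
have: y * y' != 0 by rewrite mulf_neq0.
have: z * z' != 0 by rewrite mulf_neq0.
move: E; move: (x * x') (y * y') (z * z') => u v w E w0 v0 u0.
case: (ltgtP 0 u) u0 => // Hu _; case: (ltgtP 0 v) v0 => // Hv _;
  case: (ltgtP 0 w) w0 => // Hw _; exfalso; lra.
Qed.

Lemma affine_signsP (x y z t : R) : x - y + z - t = 0 ->
  x != 0 -> y != 0 -> z != 0 -> t != 0 ->
  affine_signs (0 < x) (0 < y) (0 < z) (0 < t).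
Proof.
rewrite /affine_signs => E x0 y0 z0 t0.
case: (ltgtP 0 x) x0 => // Hx _; case: (ltgtP 0 y) y0 => // Hy _;
  case: (ltgtP 0 z) z0 => // Hz _; case: (ltgtP 0 t) t0 => // Ht _;
  exfalso; lra.
Qed.

(* The Grassmann-Pluecker relations based at each of the five points, and the
   affine relation between the determinants of each four of them. *)
Definition five_point_signs (abc abd abe acd ace ade bcd bce bde cde : bool) :=
  [&& pluecker_signs abc ade abd ace abe acd,
      pluecker_signs abc bde abd bce abe bcd,
      pluecker_signs abc cde acd bce ace bcd,
      pluecker_signs abd cde acd bde ade bcd,
      pluecker_signs abe cde ace bde ade bce,
      affine_signs bcd acd abd abc, affine_signs bce ace abe abc,
      affine_signs bde ade abe abd, affine_signs cde ade ace acd &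
      affine_signs cde bde bce bcd].

Lemma five_point_signsP a b c d e : uniq [:: a; b; c; d; e] ->
  five_point_signs (o a b c) (o a b d) (o a b e) (o a c d) (o a c e)
    (o a d e) (o b c d) (o b c e) (o b d e) (o c d e).
Proof.
move=> /uniq5_neq[[nab nac nad nae] [nbc nbd nbe] [ncd nce] nde].
rewrite /o /ori.
apply/and5P; split; [.. | apply/and5P; split; [.. | apply/andP; split]];
  (apply: pluecker_signsP || apply: affine_signsP);
  rewrite ?genP //; rewrite /det3; ring.
Qed.

Definition inside i j (k d : I) := (o i j d == o j k d) && (o j k d == o k i d).

(** The Jordan curve theorem modulo 2 for a triangle. Both sides depend only on the ten
    orientations, and [five_point_signs] excludes all assignments violating the equality. *)
Lemma triangle_crossings i j k d e : uniq [:: i; j; k; d; e] ->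
  cr i j d e (+) cr j k d e (+) cr k i d e = inside i j k d (+) inside i j k e.
Proof.
move=> u; have signs := five_point_signsP u.
have [[nij nik nid nie] [njk njd nje] [nkd nke] nde] := uniq5_neq u.
apply/eqP; apply: implyP signs; rewrite /inside /cr /crosses /o.
(* Reduce to the ten orientations of triples in the order [i, j, k, d, e]. *)
rewrite !(ori_cycle (P i) (P d)) !(ori_cycle (P j) (P d)).
rewrite !(ori_cycle (P k) (P d)).
rewrite !(@ori_swap _ (P i) (P k)) ?genP //.
move: (ori (P i) (P j) (P k)) (ori (P i) (P j) (P d)) (ori (P i) (P j) (P e))
  (ori (P i) (P k) (P d)) (ori (P i) (P k) (P e)) (ori (P i) (P d) (P e))
  (ori (P j) (P k) (P d)) (ori (P j) (P k) (P e)) (ori (P j) (P d) (P e))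
  (ori (P k) (P d) (P e)).
by apply: bool10_ind; vm_compute.
Qed.

(** The fifteen terms are the pairs of independent edges; again all assignments allowed by
    [five_point_signs] are tested. *)
Lemma K5_straight_crossings a b c d e : uniq [:: a; b; c; d; e] ->
  cr a b c d (+) cr a b c e (+) cr a b d e (+) cr a c b d (+) cr a c b e
  (+) cr a c d e (+) cr a d b c (+) cr a d b e (+) cr a d c e (+) cr a e b c
  (+) cr a e b d (+) cr a e c d (+) cr b c d e (+) cr b d c e (+) cr b e c d.
Proof.
move=> u; have signs := five_point_signsP u.
have [[nab nac nad nae] [nbc nbd nbe] [ncd nce] nde] := uniq5_neq u.
apply: implyP signs; rewrite /cr /crosses /o !(ori_cycle (P a)).
rewrite !(@ori_swapr _ _ (P b) (P c), @ori_swapr _ _ (P b) (P d),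
  @ori_swapr _ _ (P b) (P e), @ori_swapr _ _ (P c) (P d),
  @ori_swapr _ _ (P c) (P e), @ori_swapr _ _ (P d) (P e)) ?genP //;
  try by rewrite eq_sym.
rewrite !(@ori_swap _ (P b) (P c), @ori_swap _ (P b) (P d),
  @ori_swap _ (P c) (P d)) ?genP //.
move: (ori (P a) (P b) (P c)) (ori (P a) (P b) (P d)) (ori (P a) (P b) (P e))
  (ori (P a) (P c) (P d)) (ori (P a) (P c) (P e)) (ori (P a) (P d) (P e))
  (ori (P b) (P c) (P d)) (ori (P b) (P c) (P e)) (ori (P b) (P d) (P e))
  (ori (P c) (P d) (P e)).
by apply: bool10_ind; vm_compute.
Qed.

(* [(f, n)] visits f 0, ..., f n; later values of f are irrelevant. *)
Definition walk := ((nat -> I) * nat)%type.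
Implicit Types w q : walk.

Definition walk_start w := w.1 0%N.
Definition walk_end w := w.1 w.2.
(** The indices are unbounded, so values past the ends of the walks count too. *)
Definition disjoint_walks w q := forall k l, w.1 k != q.1 l.

Definition straight w : walk :=
  (fun k : nat => if k == 0%N then walk_start w else walk_end w, 1%N).

(* The two-element field of parities is [bool] with its ring structure. *)
Definition edge_parity i j q : bool :=
  \sum_(0 <= l < q.2) (cr i j (q.1 l) (q.1 l.+1)).

Definition parity w q : bool :=
  \sum_(0 <= k < w.2) edge_parity (w.1 k) (w.1 k.+1) q.

Lemma parity_neq0 w q : parity w q -> exists k l,
  [/\ (k < w.2)%N, (l < q.2)%N & cr (w.1 k) (w.1 k.+1) (q.1 l) (q.1 l.+1)].
Proof.
move=> odd; apply: contrapT => no_crossing; move: odd.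
rewrite /parity big_nat big1 // => k /= kw.
rewrite /edge_parity big_nat big1 // => l /= lq.
by apply/negbTE/negP => klc; apply: no_crossing; exists k, l.
Qed.

Lemma parityC w q : parity w q = parity q w.
Proof.
rewrite /parity /edge_parity exchange_big /=.
by apply: eq_bigr => l _; apply: eq_bigr => k _; rewrite /cr crossesC.
Qed.

Lemma parity_straight w q :
  parity (straight w) q = edge_parity (walk_start w) (walk_end w) q.
Proof. by rewrite /parity /= big_nat1. Qed.

Lemma disjoint_straight w q :
  disjoint_walks w q -> disjoint_walks w (straight q).
Proof. by move=> d k [|l]; apply: d. Qed.

Lemma bool_telescope (f : nat -> bool) n :
  \sum_(0 <= l < n) (f l + f l.+1) = f 0%N + f n.
Proof.
elim: n => [|n IH]; first by rewrite big_geq //; case: (f _).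
rewrite big_nat_recr //= IH.
by case: (f 0%N) (f n) (f n.+1) => [] [] [].
Qed.

Lemma edge_parityxx i q : edge_parity i i q = 0.
Proof. by rewrite /edge_parity big1 // => l _; rewrite /cr crossesxx. Qed.

Lemma edge_parityC i j q : i != j -> (forall l, i != q.1 l) ->
  (forall l, j != q.1 l) -> edge_parity j i q = edge_parity i j q.
Proof.
by move=> ij iq jq; apply: eq_bigr => l _; rewrite /cr crossesNl // genP.
Qed.

(** Summing [triangle_crossings] along [q] telescopes. *)
Lemma triangle_parity i j k q : i != j -> j != k -> i != k ->
  (forall l, i != q.1 l) -> (forall l, j != q.1 l) -> (forall l, k != q.1 l) ->
  edge_parity i j q + edge_parity j k q + edge_parity k i q =
  inside i j k (walk_start q) + inside i j k (walk_end q).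
Proof.
move=> ij jk ik iq jq kq.
rewrite -(bool_telescope (fun l => inside i j k (q.1 l))) -!big_split /=.
apply: eq_bigr => l _; have [->|dl] := eqVneq (q.1 l) (q.1 l.+1).
  by rewrite /cr !crossesxxr; case: (inside _ _ _ _).
have u : uniq [:: i; j; k; q.1 l; q.1 l.+1].
  by rewrite /= !inE !negb_or ij jk ik dl !iq !jq !kq.
exact: (triangle_crossings u).
Qed.

(* As a function of [w], the parity of the crossings with a closed curve is
   that of a potential, so it only depends on the end points. *)
Lemma parity_closed w q1 q2 q3 :
  walk_start q1 = walk_start q3 -> walk_end q1 = walk_start q2 ->
  walk_end q2 = walk_end q3 ->
  disjoint_walks w q1 -> disjoint_walks w q2 -> disjoint_walks w q3 ->
  parity w q1 + parity w q2 + parity w q3 =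
  parity (straight w) q1 + parity (straight w) q2 + parity (straight w) q3.
Proof.
move=> e13 e12 e23 d1 d2 d3.
pose F i j : bool :=
  edge_parity i j q1 + edge_parity i j q2 + edge_parity i j q3.
pose avoids i := [/\ forall l, i != q1.1 l, forall l, i != q2.1 l
                   & forall l, i != q3.1 l].
have Fxx i : F i i = 0 by rewrite /F !edge_parityxx.
have FC i j : avoids i -> avoids j -> F j i = F i j.
  move=> [i1 i2 i3] [j1 j2 j3]; have [->//|ij] := eqVneq i j.
  by congr (_ + _ + _); apply: edge_parityC.
have Ftri i j k : avoids i -> avoids j -> avoids k -> F i j + F j k = F i k.
  move=> ai aj ak; have [<-|ij] := eqVneq i j; first by rewrite Fxx add0r.
  have [<-|jk] := eqVneq j k; first by rewrite Fxx addr0.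
  have [<-|ik] := eqVneq i k; first by rewrite (FC i j) // Fxx; case: (F i j).
  rewrite -(FC i k) //.
  have bool_eq0 (x y z : bool) : x + y + z = 0 -> x + y = z.
    by case: x y z => [] [] [].
  apply: bool_eq0; case: ai aj ak => i1 i2 i3 [j1 j2 j3] [k1 k2 k3].
  have t1 := triangle_parity ij jk ik i1 j1 k1.
  have t2 := triangle_parity ij jk ik i2 j2 k2.
  have t3 := triangle_parity ij jk ik i3 j3 k3.
  transitivity (edge_parity i j q1 + edge_parity j k q1 + edge_parity k i q1 +
    (edge_parity i j q2 + edge_parity j k q2 + edge_parity k i q2) +
    (edge_parity i j q3 + edge_parity j k q3 + edge_parity k i q3)).
    by rewrite /F; ring.
  (* The three walks close up, so each [inside] term occurs twice. *)
  rewrite t1 t2 t3 e13 e12 e23.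
  by case: (inside _ _ _ _) (inside _ _ _ _) (inside _ _ _ _) => [] [] [].
have aw k : avoids (w.1 k) by split=> l; rewrite ?d1 ?d2 ?d3.
rewrite !parity_straight -/(F _ _) /parity -!big_split /=.
rewrite /walk_end; elim: (w.2) => [|n IH]; first by rewrite big_geq // Fxx.
by rewrite big_nat_recr //= IH; apply: Ftri (aw 0%N) (aw n) (aw n.+1).
Qed.

Lemma K5_walks_cross (W : nat -> nat -> walk) (v : nat -> I) :
  (forall x y, (x < y < 5)%N ->
    walk_start (W x y) = v x /\ walk_end (W x y) = v y) ->
  uniq [seq v x | x <- iota 0 5] ->
  (forall x y z t, (x < y < 5)%N -> (z < t < 5)%N -> uniq [:: x; y; z; t] ->
    disjoint_walks (W x y) (W z t)) ->
  exists x y z t, [/\ (x < y < 5)%N, (z < t < 5)%N, uniq [:: x; y; z; t]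
    & parity (W x y) (W z t)].
Proof.
move=> ends uniq_v disj; apply: contrapT => no_crossing.
have W0 x y z t : (x < y < 5)%N && (z < t < 5)%N && uniq [:: x; y; z; t] ->
    parity (W x y) (W z t) = 0.
  move=> /andP[/andP[xy zt] u]; apply/negbTE/negP => odd.
  by apply: no_crossing; exists x, y, z, t.
(* [s] records whether the walk has already been straightened. *)
pose C (s : bool) x y := if s then straight (W x y) else W x y.
(* [a], [b], [c] are the vertices other than [x] and [y]; the walks between them close up, as
   [parity_closed] requires. *)
have step x y a b c s1 s2 s3 :
    [&& x < y < 5, a < b < c, c < 5 & uniq [:: x; y; a; b; c]]%N ->
    parity (W x y) (C s1 a b) + parity (W x y) (C s2 b c) +
      parity (W x y) (C s3 a c) =
    parity (straight (W x y)) (C s1 a b) +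
      parity (straight (W x y)) (C s2 b c) +
      parity (straight (W x y)) (C s3 a c).
  move=> /and4P[xy /andP[ab bc] c5 u].
  have [[nxy nxa nxb nxc] [nya nyb nyc] [nab nac] nbc] := uniq5_neq u.
  have CE s (i j : nat) : walk_start (C s i j) = walk_start (W i j) /\
                  walk_end (C s i j) = walk_end (W i j) by case: s.
  have disjC s (i j : nat) : (i < j < 5)%N -> uniq [:: x; y; i; j] ->
      disjoint_walks (W x y) (C s i j).
    by move=> ij u4; case: s; [apply: disjoint_straight|]; apply: disj.
  have ab5 : (a < b < 5)%N by rewrite ab (ltn_trans bc).
  have bc5 : (b < c < 5)%N by rewrite bc.
  have ac5 : (a < c < 5)%N by rewrite (ltn_trans ab).
  have [sab eab] := ends a b ab5; have [sbc ebc] := ends b c bc5.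
  have [sac eac] := ends a c ac5.
  have [Cs1 Ce1] := CE s1 a b; have [Cs2 Ce2] := CE s2 b c.
  have [Cs3 Ce3] := CE s3 a c.
  apply: parity_closed;
    rewrite ?Cs1 ?Cs2 ?Cs3 ?Ce1 ?Ce2 ?Ce3 ?sab ?sac ?sbc ?eab ?eac ?ebc //;
    apply: disjC;
    rewrite /= ?inE ?negb_or ?nxy ?nxa ?nxb ?nxc ?nya ?nyb ?nyc ?nab ?nac
      ?nbc //.
have crE x y z t : (x < y < 5)%N && (z < t < 5)%N ->
    cr (v x) (v y) (v z) (v t) = parity (straight (W x y)) (straight (W z t)).
  case/andP=> /ends[<- <-] /ends[<- <-].
  by rewrite parity_straight /edge_parity big_nat1.
(* The edges are straightened in reverse lexicographic order. Summing the ten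
   equations, every parity of a path against a segment appears on both sides. *)
have E01 := step 0 1 2 3 4 true true true isT.
have E02 := step 0 2 1 3 4 true true true isT.
have E03 := step 0 3 1 2 4 true true true isT.
have E04 := step 0 4 1 2 3 true true true isT.
have E12 := step 1 2 0 3 4 false true false isT.
have E13 := step 1 3 0 2 4 false true false isT.
have E14 := step 1 4 0 2 3 false true false isT.
have E23 := step 2 3 0 1 4 false false false isT.
have E24 := step 2 4 0 1 3 false false false isT.
have E34 := step 3 4 0 1 2 false false false isT.
(* Two unstraightened walks have parity 0; the mixed parities are written with the segment
   second. *)
rewrite /C !W0 //= !(parityC (straight _) (W _ _)) in
  E01 E02 E03 E04 E12 E13 E14 E23 E24 E34.
have /eqP := congr2 +%R E01 (congr2 +%R E02 (congr2 +%R E03 (congr2 +%R E04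
  (congr2 +%R E12 (congr2 +%R E13 (congr2 +%R E14 (congr2 +%R E23
  (congr2 +%R E24 E34)))))))).
rewrite -subr_eq0 => /eqP total.
have odd := K5_straight_crossings uniq_v.
(* Each of the fifteen pairs of segments occurs in exactly one right-hand side. *)
have even : cr (v 0) (v 1) (v 2) (v 3) +
  cr (v 0) (v 1) (v 2) (v 4) +
  cr (v 0) (v 1) (v 3) (v 4) +
  cr (v 0) (v 2) (v 1) (v 3) +
  cr (v 0) (v 2) (v 1) (v 4) +
  cr (v 0) (v 2) (v 3) (v 4) +
  cr (v 0) (v 3) (v 1) (v 2) +
  cr (v 0) (v 3) (v 1) (v 4) +
  cr (v 0) (v 3) (v 2) (v 4) +
  cr (v 0) (v 4) (v 1) (v 2) +
  cr (v 0) (v 4) (v 1) (v 3) +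
  cr (v 0) (v 4) (v 2) (v 3) +
  cr (v 1) (v 2) (v 3) (v 4) +
  cr (v 1) (v 3) (v 2) (v 4) +
  cr (v 1) (v 4) (v 2) (v 3) = 0.
  by apply: oppr_inj; rewrite oppr0 -total !crE //; ring.
by have := etrans (esym odd) even.
Qed.
End GenericConfigurations.

(** * Perturbing finitely many points into general position *)

Section Perturbation.
Local Open Scope ring_scope.

(* Moving the n-th point by t (n, n^2) makes each det3 a polynomial in t whose
   leading coefficient is a Vandermonde determinant. *)
Lemma generic_perturbation (R : realFieldType) (I : finType) (P : I -> R * R)
    (e : R) : 0 < e ->
  exists2 Q : I -> R * R, generic Q &
    forall i, `|(Q i).1 - (P i).1| < e /\ `|(Q i).2 - (P i).2| < e.
Proof.
move=> e0; pose c (i : I) : R := (enum_rank i)%:R.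
have c_inj i j : i != j -> c j - c i != 0.
  apply: contra_neq => /eqP; rewrite subr_eq0 eqr_nat => /eqP h.
  by apply/esym/enum_rank_inj/val_inj.
pose Q t i : R * R := ((P i).1 + t * c i, (P i).2 + t * c i ^+ 2).
pose p i j k : {poly R} := det3 (P i) (P j) (P k) *: 1 +
  (((P j).1 - (P i).1) * (c k ^+ 2 - c i ^+ 2)
   + (c j - c i) * ((P k).2 - (P i).2)
   - ((P j).2 - (P i).2) * (c k - c i)
   - (c j ^+ 2 - c i ^+ 2) * ((P k).1 - (P i).1))
    *: 'X + ((c j - c i) * (c k - c i) * (c k - c j)) *: 'X^2.
have pE i j k t : (p i j k).[t] = det3 (Q t i) (Q t j) (Q t k).
  by rewrite /p !hornerE /det3 /Q /=; ring.
have p_neq0 i j k : i != j -> j != k -> i != k -> p i j k != 0.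
  move=> ij jk ik; apply/eqP => /(congr1 (fun q : {poly R} => q`_2)).
  rewrite !coefE /= mulr0 !add0r mulr1 mulr0 add0r.
  by apply/eqP; rewrite !mulf_neq0 ?c_inj.
pose distinct (u : I * I * I) :=
  [&& u.1.1 != u.1.2, u.1.2 != u.2 & u.1.1 != u.2].
(* The roots of [q] are the parameters [t] for which some triple becomes collinear. *)
pose q : {poly R} := \prod_(u | distinct u) p u.1.1 u.1.2 u.2.
have q0 : q != 0 by apply/prodf_neq0 => u /and3P[]; apply: p_neq0.
(* The shifts [t * c i] and [t * c i ^+ 2] are at most [t * #|I| ^ 2]; adding 1 makes the bound by
   [e] strict. *)
pose M : R := (#|I| ^ 2)%:R + 1; have M0 : 0 < M by rewrite ltr_wpDl.
pose s (n : nat) := e / M / n.+1%:R.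
have s0 n : 0 < s n by rewrite !divr_gt0.
(* A nonzero polynomial has fewer roots than its size, so one of these [size q] distinct parameters
   is not a root. *)
have /allPn[t /mapP[n _ tE] qt] :
    ~~ all (root q) [seq s n | n <- iota 0 (size q)].
  apply/negP => /(max_poly_roots q0).
  rewrite map_inj_uniq ?iota_uniq ?size_map ?size_iota ?ltnn.
    by move=> /(_ isT).
  move=> m n.
  move/(mulfI (lt0r_neq0 (divr_gt0 e0 M0)))/invr_inj/eqP.
  by rewrite eqr_nat => /eqP[].
exists (Q t) => [i j k ij jk ik|i].
  apply: contra qt; rewrite -pE => pt; rewrite /root horner_prod.
  by rewrite (bigD1 (i, j, k)) /= ?(eqP pt) ?mul0r // /distinct /= ij jk ik.
have small m : (m <= #|I| ^ 2)%N -> `|s n * m%:R| < e.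
  move=> mI; rewrite ger0_norm; last by rewrite mulr_ge0 // ltW.
  apply: (@le_lt_trans _ _ (e / M * (#|I| ^ 2)%:R)).
    apply: ler_pM; rewrite ?ler_nat //; first exact: ltW.
    by rewrite ler_pdivrMr // ler_peMr ?ler1n // ltW // divr_gt0.
  by rewrite mulrAC ltr_pdivrMr // ltr_pM2l // /M ltrDl.
have cI := ltn_ord (enum_rank i).
rewrite /Q tE /= !(addrC (P i).1, addrC (P i).2) !addrK /c -natrX.
split; apply: small; last by rewrite leq_exp2r // ltnW.
by rewrite (leq_trans (ltnW cI)) // -mulnn leq_pmulr // (leq_trans _ cI).
Qed.

End Perturbation.

(** * Continuous paths and their polygonal approximation *)

Section Paths.
Import numFieldNormedType.Exports.
Local Open Scope ring_scope.
Context {R : realType}.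
Implicit Types g h : R -> R * R.
Let I01 : set R := `[0, 1]%classic.

Lemma ex_near_right (J : finType) (Q : J -> R -> Prop) :
  (forall i, \forall e \near 0^'+, Q i e) -> exists2 e, 0 < e & forall i, Q i e.
Proof.
move=> /filter_forall nearQ; near (0 : R)^'+ => e; exists e.
  by near: e; exact: nbhs_right_gt.
by near: e; apply: nearQ.
Unshelve. all: by end_near. Qed.

(** Heine-Cantor, from the near-covering form of compactness. The conclusion uses [\near] so that
    [ex_near_right] yields one [d] for all edges. *)
Lemma path_unif_continuous g (e : R) : {within I01, continuous g} -> 0 < e ->
  \forall d \near 0^'+, forall s t : R, I01 s -> I01 t -> `|s - t| < d ->
    `|g s - g t| < e.
Proof.
move=> /subspace_continuousP gc e0.
have /compact_near_coveringP/near_covering_withinP cover :=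
  @segment_compact R 0 1.
have : \forall d \near 0^'+, I01 `<=` [set s | forall t, I01 t ->
    `|s - t| < d -> `|g s - g t| < e].
  apply: cover => x Ix; have e20 : 0 < e / 2 by rewrite divr_gt0.
  have /cvgrPdist_lt/(_ _ e20) := gc x Ix.
  rewrite near_withinE => /nbhs_ballP[r /= r0 gr].
  (* Half of [r] is for [s] near [x], the other half for [t] near [s]. *)
  exists (ball x (r / 2), [set d | d < r / 2]); first split => /=.
  - by apply: nbhsx_ballx; rewrite divr_gt0.
  - by apply: nbhs_right_lt; rewrite divr_gt0.
  move=> [s d] [/= xs dr] Is t It st.
  have xt : ball x r t.
    rewrite [r]splitr; apply: (le_lt_trans (ler_distD s _ _)).
    by apply: ltrD => //; apply: lt_trans dr.
  have {}xs : ball x r s.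
    by apply: le_ball xs; rewrite ler_pdivrMr // ler_peMr ?ler1n // ltW.
  rewrite [e]splitr; apply: le_lt_trans (ler_distD (g x) _ _) _.
  by rewrite distrC; apply: ltrD; [apply: gr xs Is | apply: gr xt It].
by apply: filterS => d h s t Is; apply: h.
Qed.

(** The distance attains its minimum on the product of the compact images, and it is positive there
    by disjointness. *)
Lemma paths_separated g h : {within I01, continuous g} ->
  {within I01, continuous h} ->
  (forall s t, I01 s -> I01 t -> g s <> h t) ->
  \forall e \near 0^'+, forall s t, I01 s -> I01 t -> e <= `|g s - h t|.
Proof.
move=> gc hc disj; pose A := (g @` I01) `*` (h @` I01).
have I0 : I01 0 by rewrite /I01 /= in_itv /= lexx ler01.
have A0 : A !=set0 by exists (g 0, h 0); split; exists 0.
have cA : compact A.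
  by apply: compact_setX; apply: continuous_compact => //;
    apply: segment_compact.
have [|c /set_mem[[s Is gs] [t It ht]] cmin] := @compact_EVT_min _ R
  (fun p : (R * R) * (R * R) => `|p.1 - p.2|) A A0 cA.
  apply: continuous_subspaceT => p; apply: cvg_norm.
  by apply: cvgB; [apply: cvg_fst | apply: cvg_snd].
have m0 : 0 < `|c.1 - c.2|.
  by rewrite normr_gt0 subr_eq0 -gs -ht; apply/eqP/disj.
near=> e => s' t' Is' It'.
apply: le_trans (cmin (g s', h t') _); last first.
  by apply/mem_set; split; [exists s'|exists t'].
by near: e; apply: nbhs_right_le.
Unshelve. all: by end_near. Qed.

(* Inscribed polygonal paths with slightly perturbed vertices are in general
   position, and those of two disjoint arcs stay disjoint. *)
Lemma K5_paths_meet (pos : nat -> R * R) (g : nat -> nat -> R -> R * R) :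
  (forall x y, (x < y < 5)%N -> [/\ {within I01, continuous (g x y)},
     g x y 0 = pos x & g x y 1 = pos y]) ->
  exists x y z t, [/\ (x < y < 5)%N, (z < t < 5)%N, uniq [:: x; y; z; t] &
    exists s r, [/\ I01 s, I01 r & g x y s = g z t r]].
Proof.
move=> gP; apply: contrapT => no_meet.
have [e e0 sep] : exists2 e : R, 0 < e & forall x y z t, (x < y < 5)%N ->
    (z < t < 5)%N -> uniq [:: x; y; z; t] ->
    forall s r, I01 s -> I01 r -> e <= `|g x y s - g z t r|.
  have near_sep (u : 'I_5 * 'I_5 * ('I_5 * 'I_5)) : \forall e \near 0^'+,
      (u.1.1 < u.1.2)%N -> (u.2.1 < u.2.2)%N ->
      uniq [:: val u.1.1; val u.1.2; val u.2.1; val u.2.2] ->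
      forall s r, I01 s -> I01 r -> e <= `|g u.1.1 u.1.2 s - g u.2.1 u.2.2 r|.
    case: u => [[x y] [z t]] /=.
    have [xyzt|no] := pselect [/\ (x < y)%N, (z < t)%N &
      uniq [:: val x; val y; val z; val t]]; last first.
      by apply: nearW => e xy zt u; case: no.
    case: xyzt => xy zt u.
    have xy5 : (x < y < 5)%N by rewrite xy ltn_ord.
    have zt5 : (z < t < 5)%N by rewrite zt ltn_ord.
    have [cg _ _] := gP _ _ xy5; have [ch _ _] := gP _ _ zt5.
    have disj s r : I01 s -> I01 r -> g x y s <> g z t r.
      move=> Is Ir meet; apply: no_meet.
      by exists x, y, z, t; split=> //; exists s, r.
    by have := paths_separated cg ch disj; apply: filterS => e he _ _ _.
  have [e e0 sep] := ex_near_right near_sep.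
  exists e => // x y z t /andP[xy y5] /andP[zt t5].
  exact: (sep (Ordinal (ltn_trans xy y5), Ordinal y5,
    (Ordinal (ltn_trans zt t5), Ordinal t5))).
(* One quarter is for the curve between neighbouring grid points, one for the perturbation: segments
   stay within [e / 2] of the curves, so crossing ones bring two curves closer than [e]. *)
have e40 : 0 < e / 4 by rewrite divr_gt0.
have [d d0 unif] : exists2 d : R, 0 < d & forall x y, (x < y < 5)%N ->
    forall s t, I01 s -> I01 t -> `|s - t| < d -> `|g x y s - g x y t| < e / 4.
  have near_unif (u : 'I_5 * 'I_5) : \forall d \near 0^'+, (u.1 < u.2)%N ->
      forall s t, I01 s -> I01 t -> `|s - t| < d ->
      `|g u.1 u.2 s - g u.1 u.2 t| < e / 4.
    case: u => x y /=; have [xy|yx] := ltnP x y; last exact: nearW.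
    have xy5 : (x < y < 5)%N by rewrite xy ltn_ord.
    have [cg _ _] := gP _ _ xy5.
    by have := path_unif_continuous cg e40; apply: filterS => d h _.
  have [d d0 unif] := ex_near_right near_unif.
  exists d => // x y /andP[xy y5].
  exact: (unif (Ordinal (ltn_trans xy y5), Ordinal y5)).
have [N Nd] : exists N, N.+1%:R^-1 < d.
  have [N _ small] := near_infty_natSinv_lt (PosNum d0).
  by exists N; apply: (small N (leqnn N)).
have grid01 k : (k <= N.+1)%N -> I01 (k%:R / N.+1%:R).
  move=> kN; rewrite /I01 /= in_itv /= divr_ge0 //= ler_pdivrMr // mul1r.
  by rewrite ler_nat.
(* The five vertices have one index each, shared by all walks that start or end there; inner nodes
   are indexed by edge and position. *)
pose I : finType := ('I_5 + 'I_5 * 'I_5 * 'I_N.+1)%type.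
pose P (i : I) := match i with
  | inl x => pos x
  | inr (x, y, k) => g x y (k%:R / N.+1%:R)
  end.
pose v x : I := inl (inord x).
pose node x y k : I :=
  if k == 0%N then v x else if k == N.+1 then v y
  else inr (inord x, inord y, inord k).
have PE x y k : (x < y < 5)%N -> (k <= N.+1)%N ->
    P (node x y k) = g x y (k%:R / N.+1%:R).
  move=> xy5 kN; have [_ g0 g1] := gP x y xy5; case/andP: xy5 => xy y5.
  rewrite /node; have [->|k0] := eqVneq k 0%N.
    by rewrite mul0r g0 /= inordK // (ltn_trans xy).
  have [->|kN1] := eqVneq k N.+1.
    by rewrite divff ?g1 /= ?inordK // pnatr_eq0.
  by rewrite /= !inordK ?(ltn_trans xy) // ltn_neqAle kN1.
have [Q genQ QP] := generic_perturbation P e40.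
have := @K5_walks_cross R I Q genQ (fun x y => (node x y, N.+1)) v.
have v_inj x y : (x < 5)%N -> (y < 5)%N -> v x = v y -> x = y.
  by move=> x5 y5 [/(congr1 val)]; rewrite /= !inordK.
case=> [x y _|||x [y [z [t [xy5 zt5 u]]]]].
- by rewrite /walk_start /walk_end /node /= eqxx.
- rewrite map_inj_in_uniq ?iota_uniq // => x y; rewrite !mem_iota => x5 y5.
  exact: v_inj.
- move=> x y z t /andP[xy y5] /andP[zt t5] + k l.
  have x5 := ltn_trans xy y5; have z5 := ltn_trans zt t5.
  rewrite /= !inE !negb_or => /and4P[/and3P[_ xz xt] /andP[yz yt] _ _].
  have neq a b : a != b -> (a < 5)%N -> (b < 5)%N -> v a != v b.
    by move=> + a5 b5; apply: contra_neq; apply: v_inj.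
  rewrite /node; case: ifP => _; [|case: ifP => _];
    (case: ifP => _; [|case: ifP => _]); rewrite ?neq //.
  (* The first vertices differ, which separates inner nodes whatever [k] and [l] are. *)
  apply: contra_neq xz => -[/(congr1 val) + _ _].
  by rewrite /= !inordK.
move=> /parity_neq0[k [l [/= kN lN cross]]].
(* Both ends of a segment are compared with the same point of the curve, as [crosses_close]
   requires. *)
have nodeQ x' y' k' : (x' < y' < 5)%N -> (k' < N.+1)%N ->
   [/\ `|(Q (node x' y' k')).1 - (g x' y' (k'%:R / N.+1%:R)).1| < e / 2,
       `|(Q (node x' y' k')).2 - (g x' y' (k'%:R / N.+1%:R)).2| < e / 2,
       `|(Q (node x' y' k'.+1)).1 - (g x' y' (k'%:R / N.+1%:R)).1| < e / 2 &
       `|(Q (node x' y' k'.+1)).2 - (g x' y' (k'%:R / N.+1%:R)).2| < e / 2].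
  move=> xy5' kN'; set p := g x' y' _.
  have close i : `|P i - p| < e / 4 ->
      `|(Q i).1 - p.1| < e / 2 /\ `|(Q i).2 - p.2| < e / 2.
    rewrite prod_normE gt_max => /andP[/= P1 P2]; have [Q1 Q2] := QP i.
    have -> : e / 2 = e / 4 + e / 4 by field.
    split; [apply: le_lt_trans (ler_distD (P i).1 _ _) _
           |apply: le_lt_trans (ler_distD (P i).2 _ _) _]; exact: ltrD.
  have [] := close (node x' y' k'); first by rewrite PE ?subrr ?normr0 // ltnW.
  have [] := close (node x' y' k'.+1); last by [].
  rewrite PE //; apply: unif => //; try exact: grid01.
    by apply: grid01; apply: ltnW.
  by rewrite -mulrBl -natrB // subSnn mul1r ger0_norm // invr_ge0.
have [a1 a2 b1 b2] := nodeQ x y k xy5 kN.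
have [c1 c2 d1 d2] := nodeQ z t l zt5 lN.
have [near1 near2] := crosses_close a1 a2 b1 b2 c1 c2 d1 d2 cross.
have := sep x y z t xy5 zt5 u _ _ (grid01 k (ltnW kN)) (grid01 l (ltnW lN)).
by rewrite leNgt prod_normE gt_max [e]splitr near1 near2.
Qed.
End Paths.

(** * Associated primes and cliques *)

Section AssociatedPrimes.
Context {S : comSemigroup0Type}.
Local Open Scope group_scope.
Implicit Types x y : S.

Lemma prime_Ann_le x y : is_prime (Ann y) -> x * y <> szero ->
  Ann x `<=` Ann y.
Proof.
move=> [_ prime_y] xy0 s; rewrite /Ann /= => sx0.
have [t|//|//] := prime_y s x.
by rewrite /Ann /= -(mulgA s) (smulC t) mulgA sx0 !smul0.
Qed.

Lemma Ann_neq_mul0 x y : is_prime (Ann x) -> is_prime (Ann y) ->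
  Ann x <> Ann y -> x * y = szero.
Proof.
move=> px py xy; apply: contrapT => xy0; apply: xy; apply/seteqP.
by split; apply: prime_Ann_le; rewrite // smulC.
Qed.

(** The vertices are generators of [n] distinct associated primes; each is a zero-divisor because
    another one annihilates it. *)
Lemma Ass_clique n : `I_n #<= Ass S -> exists x : nat -> S,
  forall i j, (i < n)%N -> (j < n)%N -> i != j -> zd_adj (x i) (x j).
Proof.
move=> /pcard_leP/unsquash p.
have pP i : (i < n)%N -> exists x : S,
    [/\ is_prime (Ann x), x <> szero & p i = Ann x].
  move=> i_n; have [pi [x x0 pix]] : Ass S (p i) by apply: funS.
  by exists x; rewrite -pix.
have /choice[x xP] i : exists x : S, (i < n)%N ->
    [/\ is_prime (Ann x), x <> szero & p i = Ann x].
  case: (ltnP i n) => [/pP[x xP]|_]; first by exists x.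
  (* A placeholder for indices outside the range. *)
  by exists szero.
exists x => i j i_n j_n ij.
have [xi xi0 pxi] := xP _ i_n; have [xj xj0 pxj] := xP _ j_n.
have Ann_neq : Ann (x i) <> Ann (x j).
  rewrite -pxi -pxj => /(@inj _ _ _ p) eq_ij; move/eqP: ij; apply.
  by apply: eq_ij; rewrite inE.
have xij0 := Ann_neq_mul0 xi xj Ann_neq.
apply/and4P; split.
- by apply/mem_set; split=> //; exists (x j).
- by apply/mem_set; split=> //; exists (x i) => //; rewrite smulC.
- by apply: contra_notN Ann_neq => /eqP ->.
- exact/eqP.
Qed.

End AssociatedPrimes.

(** * Nonplanarity of graphs containing K_5 *)

Section K5.
Import numFieldNormedType.Exports.

(** In a plane drawing two arcs meet only at common end points of their edges, so arcs of
    independent edges are disjoint, against [K5_paths_meet]. *)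
Lemma K5_not_planar (R : realType) (T : eqType) (G : ugraph T) (x : nat -> T) :
  (forall i j, (i < 5)%N -> (j < 5)%N -> i != j -> adj G (x i) (x j)) ->
  ~ planar R G.
Proof.
move=> clique [pos [arc drawing]].
have edge i j : (i < j < 5)%N -> adj G (x i) (x j).
  by case/andP=> ij j5; rewrite clique ?(ltn_trans ij) // ltn_eqF.
have x_neq i j : (i < 5)%N -> (j < 5)%N -> i != j -> x i <> x j.
  by move=> i5 j5 ij xij; have := clique i j i5 j5 ij; rewrite xij adj_irrefl.
have path_ex (u : nat * nat) : exists g : R -> R * R, (u.1 < u.2 < 5)%N ->
    [/\ {within `[0%R, 1%R], continuous g}, g 0%R = pos (x u.1),
        g 1%R = pos (x u.2) & g @` `[0%R, 1%R] = arc [set x u.1; x u.2]].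
  case: (boolP (u.1 < u.2 < 5)%N) => [/edge u_adj|_]; last first.
    by exists (cst (0, 0)%R).
  by have [g [? _ ? ? ?]] := drawing_arc drawing u_adj; exists g.
have [g gP] := choice path_ex.
have [i j ij5|i [j [k [l [ij5 kl5 u [s [t [Is It meet]]]]]]]] :=
  @K5_paths_meet R (pos \o x) (fun i j => g (i, j)).
  by have [? ? ? _] := gP (i, j) ij5.
have [_ _ _ gij] := gP (i, j) ij5; have [_ _ _ gkl] := gP (k, l) kl5.
have disj : [set x i; x j] `&` [set x k; x l] = set0.
  move: u ij5 kl5; rewrite /= !inE !negb_or.
  move=> /and4P[/and3P[_ ik il] /andP[jk jl] _ _] /andP[ij j5] /andP[kl l5].
  have i5 := ltn_trans ij j5; have k5 := ltn_trans kl l5.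
  by apply/seteqP; split=> // _ [[->|->] [|]]; apply: x_neq.
have [w wij _] : (pos @` ([set x i; x j] `&` [set x k; x l])) (g (i, j) s).
  apply: (drawing_edges drawing).
  - by exists (x i), (x j); split; [apply: edge|].
  - by exists (x k), (x l); split; [apply: edge|].
  - by move=> eq_e; have : set0 (x i) by rewrite -disj -eq_e setIid; left.
  - by split; [rewrite -gij; exists s|rewrite meet -gkl; exists t].
by move: wij; rewrite disj.
Qed.

End K5.

Theorem proposition2p9 (R : realType) (S : comSemigroup0Type) :
  [/\ `I_2 #<= Ass S ->
        forall (p q : set S) (x y : S),
          Ass S p -> Ass S q -> p <> q ->
          x <> szero -> y <> szero -> p = Ann x -> q = Ann y ->
          (x * y)%g = szero,
      `I_3 #<= Ass S -> girth_is (zd_graph S) 3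
    & `I_5 #<= Ass S -> ~ planar R (zd_graph S)].
Proof.
split=> [_ p q x y [px _] [qy _] pq _ _ p_x q_y|
  /Ass_clique[x xP]|/Ass_clique[x xP]].
- by apply: Ann_neq_mul0; rewrite -?p_x -?q_y.
(* A cycle has at least 3 vertices by definition, so a triangle suffices. *)
- split=> [|c /and3P[]//].
  exists [:: x 0; x 1; x 2] => //; apply/and3P; split=> //=.
    have neq i j : (i < 3)%N -> (j < 3)%N -> i != j -> x i != x j.
      by move=> i3 j3 ij; have /and4P[] := xP i j i3 j3 ij.
    by rewrite !inE !negb_or !neq.
  by rewrite !xP.
- exact: (@K5_not_planar R S (zd_graph S) x xP).
Qed.
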